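(* Let $N\geqslant 1$ and let the functions $h_\pm$ be such that $\alpha_i^{(2j)}\in C^2(\overline{\omega})$ for all $j\leqslant N$ (and all indices $i$ for which $\alpha_i^{(2j)}$ is defined). Then the solution $u^\varepsilon$ of $-\Delta u^\varepsilon=2$ in $\Omega_\varepsilon$, $u^\varepsilon=0$ on $\partial\Omega_\varepsilon$, satisfies, as $\varepsilon\to0^+$, $$u^\varepsilon(x)=\sum_{j=1}^{N}\varepsilon^{2j}u_{2j}\left(x',\frac{x_n}{\varepsilon}\right)+\mathcal{O}(\varepsilon^{2N+2})$$ in the $C(\overline{\Omega}_\varepsilon)$-norm, where $$u_2(x',\xi_n)=\sum_{i=0}^{2}\alpha_i^{(2)}(x')\xi_n^i,\qquad u_{2j}(x',\xi_n)=\sum_{i=0}^{2j-1}\alpha_i^{(2j)}(x')\xi_n^i\quad (j\geqslant 2).$$ In particular (for those $u_{2j}$ with $j\leqslant N$), writing $d=d(x')$, $p=p(x')$, $\Delta'=\Delta_{x'}$, $$u_2=-\xi_n^2+\xi_n d+p,$$ $$u_4=-\frac{\xi_n^3}{6}\Delta' d-\frac{\xi_n^2}{2}\Delta' p+\alpha_1^{(4)}\xi_n+\alpha_0^{(4)},$$ $$u_6=\frac{\xi_n^5}{120}\Delta'^2 d+\frac{\xi_n^4}{24}\Delta'^2 p-\frac{\xi_n^3}{36}\Delta'\left\{[d^2+p]\Delta' d+3d\,\Delta' p\right\}-\frac{\xi_n^2}{12}\Delta'\left[dp\,\Delta' d+3p\,\Delta' p\right]+\alpha_1^{(6)}\xi_n+\alpha_0^{(6)},$$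 where $$\alpha_1^{(4)}=\frac16[d^2+p]\Delta' d+\frac12 d\,\Delta' p,\qquad \alpha_0^{(4)}=\frac16 dp\,\Delta' d+\frac12 p\,\Delta' p,$$ $$\alpha_1^{(6)}=\frac{1}{12}d\,\Delta'\left[dp\,\Delta' d+3p\,\Delta' p\right]+\frac1{36}[d^2+p]\,\Delta'\left\{3d\,\Delta' p+[d^2+p]\Delta' d\right\}-\frac1{24}d[d^2+2p]\Delta'^2p-\frac1{120}[d^4+3d^2p+p^2]\Delta'^2d,$$ $$\alpha_0^{(6)}=\frac{p}{12}\Delta'\left[dp\,\Delta' d+3p\,\Delta' p\right]+\frac{dp}{36}\Delta'\left\{[d^2+p]\Delta' d+3d\,\Delta' p\right\}-\frac1{24}p[d^2+p]\Delta'^2p-\frac1{120}dp[d^2+2p]\Delta'^2d.$$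
   Context: Let $n\geqslant2$, $x=(x',x_n)\in\mathbb{R}^n$ with $x'=(x_1,\ldots,x_{n-1})$. Let $\omega\subset\mathbb{R}^{n-1}$ be a bounded domain with $C^1$-boundary, and let $h_\pm=h_\pm(x')\in C(\overline{\omega})\cap C^1(\omega)$ be two functions such that $H:=h_-+h_+>0$ in $\omega$ and $H=0$ on $\partial\omega$. Put $d:=h_+-h_-$ and $p:=h_+h_-$. For small $\varepsilon>0$ let $$\Omega_\varepsilon:=\{x:\ x'\in\omega,\ -\varepsilon h_-(x')<x_n<\varepsilon h_+(x')\}.$$ $\Delta=\sum_{i=1}^n\partial^2/\partial x_i^2$, and $\Delta_{x'}=\sum_{i=1}^{n-1}\partial^2/\partial x_i^2$. The function $u^\varepsilon\in C^2(\Omega_\varepsilon)\cap C(\overline{\Omega_\varepsilon})$ is the solution of $-\Delta u^\varepsilon=2$ in $\Omega_\varepsilon$, $u^\varepsilon=0$ on $\partial\Omega_\varepsilon$. The functions $\alpha_i^{(2j)}$ on $\omega$ are defined recursively by $$\alpha_0^{(2)}:=p,\qquad \alpha_1^{(2)}:=d,\qquad \alpha_2^{(2)}:=-1,$$ and for $j\geqslant2$: $$\alpha_i^{(2j)}:=-\frac{1}{i(i-1)}\Delta_{x'}\alpha_{i-2}^{(2j-2)},\qquad 2\leqslant i\leqslant 2j-1,$$ $$\alpha_1^{(2j)}:=-\sum_{i=2}^{2j-1}\alpha_i^{(2j)}\sum_{m=0}^{i-1}(h_+)^m(-h_-)^{i-m-1},\qquad \alpha_0^{(2j)}:=\sum_{i=2}^{2j-1}\alpha_i^{(2j)}\sum_{m=1}^{i-1}(h_+)^m(-h_-)^{i-m}.$$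 The constant in $\mathcal{O}(\cdot)$ is independent of $\varepsilon$ and $x$. *)

(* Defs.v *)
From HB Require Import structures.
From mathcomp Require Import all_boot all_order all_algebra.
From mathcomp Require Import all_classical all_reals all_analysis.

Set Implicit Arguments.
Unset Strict Implicit.
Unset Printing Implicit Defensive.

Import Order.TTheory GRing.Theory Num.Theory numFieldNormedType.Exports.

Local Open Scope classical_set_scope.
Local Open Scope ring_scope.

(* Points of R^k are row vectors 'rV[R]_k; their norm is the sup norm, which
   induces the Euclidean topology. *)

Definition frontier (T : topologicalType) (A : set T) : set T :=
  closure A `\` interior A.

Definition domain (T : topologicalType) (A : set T) : Prop :=
  [/\ open A, connected A & A !=set0].

Definition partial (R : realType) (k : nat) (i : 'I_k) (f : 'rV[R]_k -> R) :
    'rV[R]_k -> R :=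
  'D_'e_i f.

Definition laplacian (R : realType) (k : nat) (f : 'rV[R]_k -> R) :
    'rV[R]_k -> R :=
  fun x => \sum_(i < k) partial i (partial i f) x.

Definition is_cont_ext (T : topologicalType) (R : realType) (A : set T)
    (f g : T -> R) : Prop :=
  {within closure A, continuous g} /\ (forall x, A x -> g x = f x).

(* f belongs to C^r(A); intended for an open set A. *)
Fixpoint Cn (R : realType) (k : nat) (r : nat) (A : set 'rV[R]_k)
    (f : 'rV[R]_k -> R) : Prop :=
  {within A, continuous f} /\
  if r is r'.+1 then
    forall i : 'I_k,
      (forall x, A x -> derivable f x 'e_i) /\ Cn r' A (partial i f)
  else True.

(* f belongs to C^r(closure A), for an open set A: all partial derivatives of
   order at most r exist in A and extend continuously to the closure.  The
   values of f itself outside A are irrelevant. *)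
Fixpoint Cn_closure (R : realType) (k : nat) (r : nat) (A : set 'rV[R]_k)
    (f : 'rV[R]_k -> R) : Prop :=
  (exists g, is_cont_ext A f g) /\
  if r is r'.+1 then
    forall i : 'I_k,
      (forall x, A x -> derivable f x 'e_i) /\ Cn_closure r' A (partial i f)
  else True.

(* Near each boundary point, up to the choice and the orientation of one
   coordinate axis i, the set A is the strict epigraph of a C^1 function of the
   remaining coordinates (col' i y is y with its i-th coordinate removed). *)
Definition C1_boundary (R : realType) (k : nat) (A : set 'rV[R]_k.+1) : Prop :=
  forall x0, frontier A x0 ->
    exists (i : 'I_k.+1) (s : bool) (g : 'rV[R]_k -> R) (r : R),
      [/\ Cn 1 setT g, 0 < r &
        forall y, ball x0 r y -> (A y <-> g (col' i y) < (-1) ^+ s * y 0 i)].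

Section ThinDomain.
Variables (R : realType) (k : nat).
Implicit Types (w : set 'rV[R]_k) (hp hm : 'rV[R]_k -> R).

(* A point x of R^(k+1) is split as x = (x', x_n). *)
Definition xprime (x : 'rV[R]_k.+1) : 'rV[R]_k := col' ord_max x.
Definition xlast (x : 'rV[R]_k.+1) : R := x 0 ord_max.

Definition thin_domain w hp hm (e : R) : set 'rV[R]_k.+1 :=
  [set x | w (xprime x) /\
           - (e * hm (xprime x)) < xlast x < e * hp (xprime x)].

Definition hdiff hp hm : 'rV[R]_k -> R := fun x => hp x - hm x.
Definition hprod hp hm : 'rV[R]_k -> R := fun x => hp x * hm x.

(* Largest index i for which alpha_i^(2j) is defined. *)
Definition alpha_top (j : nat) : nat := if j == 1%N then 2%N else (2 * j).-1%N.

(* alpha hp hm j i is alpha_i^(2j), for j >= 1 and i <= alpha_top j; it is set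
   to 0 for all other indices. *)
Fixpoint alpha hp hm (j : nat) {struct j} : nat -> 'rV[R]_k -> R :=
  match j with
  | 0 => fun _ _ => 0
  | 1 => fun i => match i with
                  | 0 => hprod hp hm
                  | 1 => hdiff hp hm
                  | 2 => fun _ => -1
                  | _ => fun _ => 0
                  end
  | (_.+1) as j'.+1 =>
      let a i x :=
        - (i * i.-1)%N%:R^-1 * laplacian (alpha hp hm j' (i - 2)%N) x in
      fun i => match i with
               | 0 => fun x =>
                   \sum_(2 <= l < 2 * j) a l x *
                     \sum_(1 <= m < l) hp x ^+ m * (- hm x) ^+ (l - m)
               | 1 => fun x =>
                   - \sum_(2 <= l < 2 * j) a l x *
                     \sum_(0 <= m < l) hp x ^+ m * (- hm x) ^+ (l - m - 1)
               | _ => fun x => if (i < 2 * j)%N then a i x else 0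
               end
  end.

(* The profile u_{2j}(x', xi). *)
Definition profile hp hm (j : nat) (x' : 'rV[R]_k) (xi : R) : R :=
  \sum_(0 <= i < (alpha_top j).+1) alpha hp hm j i x' * xi ^+ i.

Definition expansion hp hm (N : nat) (e : R) (x : 'rV[R]_k.+1) : R :=
  \sum_(1 <= j < N.+1)
    e ^+ (2 * j) * profile hp hm j (xprime x) (xlast x / e).

End ThinDomain.

Definition torsion_solution (R : realType) (k : nat) (A : set 'rV[R]_k)
    (u : 'rV[R]_k -> R) : Prop :=
  [/\ Cn 2 A u,
      {within closure A, continuous u},
      forall x, A x -> - laplacian u x = 2 &
      forall x, frontier A x -> u x = 0].

(* Main.v *)
Require Import Defs.
From HB Require Import structures.
From mathcomp Require Import all_boot all_order all_algebra.
From mathcomp Require Import all_classical all_reals all_analysis.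
From mathcomp Require Import ring lra.

Import Order.TTheory GRing.Theory Num.Theory numFieldNormedType.Exports.

Local Open Scope classical_set_scope.
Local Open Scope ring_scope.

Set Implicit Arguments.
Unset Strict Implicit.
Unset Printing Implicit Defensive.

(** The expansion is built so that it solves the problem up to a small residual.
    In the rescaled variable xi = x_n / eps the Laplacian is
    Lap' + eps^-2 d^2/dxi^2, and the recursion for the alpha_i^(2j) says exactly
    that d^2 u_(2j+2) / dxi^2 = - Lap' u_(2j), starting from
    d^2 u_2 / dxi^2 = -2 ([profile_xi2_1], [profile_xi2_rec]).  Hence the
    Laplacian of the truncated sum telescopes to
    -2 + eps^(2N) Lap' u_(2N) ([is_laplacian_expansion]).  The coefficients of
    order 0 and 1 in xi are those for which each profile vanishes at xi = h_+
    and at xi = - h_- ([profile_boundary]); they come from interpolating xi^l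
    linearly at these two points.

    The coefficients alpha_i^(2j) have continuous extensions to the closure of
    omega, and so the truncated sum extends continuously to the closure of the
    thin domain.  By density the extension vanishes on the whole boundary,
    including the lateral part, where h_+ = - h_-
    ([extended_expansion_frontier]).

    The difference between u^eps and this extension therefore vanishes on the
    boundary and has a Laplacian of size O(eps^(2N)), because Lap' u_(2N) is
    bounded.  A comparison with the parabola K (L^2 - x_n^2) / 2, where
    |x_n| <= L = O(eps) on the thin domain, gains the missing factor eps^2
    ([slab_estimate]).  The comparison rests on the maximum principle for a
    strictly positive Laplacian, which reduces to the second derivative test.

    The closed forms of u_4 and u_6 follow from the recursion by expanding the
    finite sums.  The only analytic input is that the Laplacian commutes with a
    constant factor, applied to the functions alpha_i^(4), which are twice
    differentiable in omega. *)

(** * The second derivative test *)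

(** A vanishing first and a positive second derivative force strict growth to
    the right: the difference quotients of the derivative are positive, and the
    mean value theorem integrates this. *)
Lemma increase_of_second_derivative_gt0 {R : realType} (h g : R -> R) (r : R) :
  0 < r -> (forall t : R, `|t| < r -> is_derive t 1 h (g t)) ->
  g 0 = 0 -> derivable g 0 1 -> 0 < 'D_1 g 0 ->
  exists2 t, `|t| < r & h 0 < h t.
Proof.
move=> r0 dh g0 dg gpos.
have dh0 (t : R) : 0 <= t -> t < r -> is_derive t 1 h (g t).
  by move=> t0 tr; apply: dh; rewrite ger0_norm.
have : \forall t \near 0^', 0 < t^-1 *: ((g \o shift 0) (t *: 1) - g 0).
  by have := dg; rewrite /derivable => /cvgr_gt; apply.
move=> /nbhs_ballP[s /= s0 sg].
have gt0 t : 0 < t -> t < s -> 0 < g t.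
  move=> t0 ts; have := sg t; rewrite /ball /= sub0r normrN gtr0_norm//.
  move=> /(_ ts); rewrite gt_eqF// => /(_ isT).
  by rewrite g0 addr0 subr0 [t *: 1]mulr1 [_ *: _]mulrC pmulr_lgt0 ?invr_gt0.
have [m [m0 mr ms]] : exists m : R, [/\ 0 < m, m < r & m < s].
  have [rs|sr] := leP r s; first by exists (r / 2); split; lra.
  by exists (s / 2); split; lra.
have cont_h : {within `[0, m], continuous h}.
  apply: derivable_within_continuous => t; rewrite in_itv /= => /andP[t0 tm].
  by have [] := dh0 _ t0 (le_lt_trans tm mr).
have dh0m (t : R) : t \in `]0, m[%R -> is_derive t 1 h (g t).
  by rewrite in_itv /= => /andP[t0 tm]; apply/dh0/(lt_trans tm)/mr/ltW.
exists m; first by rewrite gtr0_norm.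
have [c] := MVT m0 dh0m cont_h.
rewrite in_itv /= => /andP[c0 cm]; rewrite subr0 => hE.
by rewrite -subr_gt0 hE mulr_gt0// gt0// (lt_trans cm).
Qed.

Section SecondDerivativeTest.
Context {R : realType} {V : normedModType R}.
Implicit Types (f : V -> R) (x v : V) (t : R).

Let line_quotient f x v t :
  (fun h : R => h^-1 *: (((fun s : R => f (s *: v + x)) \o shift t) (h *: 1)
                 - f (t *: v + x))) =
  (fun h : R => h^-1 *: ((f \o shift (t *: v + x)) (h *: v) - f (t *: v + x))).
Proof.
by apply/funext => h /=; rewrite [h *: 1]mulr1 scalerDl addrA.
Qed.

Lemma derivable_line f x v t :
  derivable (fun s : R => f (s *: v + x)) t 1 <-> derivable f (t *: v + x) v.
Proof. by rewrite /derivable line_quotient. Qed.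

Lemma derive_line f x v t :
  'D_1 (fun s : R => f (s *: v + x)) t = 'D_v f (t *: v + x).
Proof. by rewrite /derive line_quotient. Qed.

(** Only the restriction of [f] to the line through [x] with direction [v]
    matters, so directional differentiability suffices. *)
Lemma second_derivative_test (A : set V) f x v : open A -> A x ->
  (forall y, A y -> derivable f y v) -> derivable ('D_v f) x v ->
  (forall y, A y -> f y <= f x) -> 'D_v ('D_v f) x <= 0.
Proof.
move=> oA Ax df ddf fmax.
have [r r0 rA] : exists2 r : R, 0 < r & forall t, `|t| < r -> A (t *: v + x).
  have : nbhs (0 : R) [set t | A (t *: v + x)].
    have cl : {for 0, continuous (fun t : R => t *: v + x)}.
      apply: cvgD; last exact: cvg_cst.
      by apply: cvgZl; exact: cvg_id.
    apply: cl; rewrite scale0r add0r; exact: open_nbhs_nbhs.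
  move=> /nbhs_ballP[r /= r0 rA]; exists r => // t tr.
  by apply: rA; rewrite /ball /= sub0r normrN.
have dh (t : R) : `|t| < r ->
    is_derive t 1 (fun s : R => f (s *: v + x)) ('D_v f (t *: v + x)).
  move=> tr; apply: DeriveDef; last exact: derive_line.
  by apply/derivable_line/df/rA.
have fle t : `|t| < r -> f (t *: v + x) <= f (0 *: v + x).
  by move=> /rA/fmax; rewrite scale0r add0r.
have in_r t : t \in `](- r), r[%R -> `|t| < r by rewrite in_itv /= -ltr_norml.
have g0 : 'D_v f (0 *: v + x) = 0.
  have rr : - r <= r by lra.
  have [||t /in_r/fle//|_ dh0] :=
    @derive1_at_max R (fun s : R => f (s *: v + x)) (- r) r 0 rr.
  - by move=> t /in_r/dh[].
  - by rewrite in_itv /= oppr_lt0 r0.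
  - by rewrite -[RHS]dh0; exact/esym/derive_line.
have dg : derivable (fun s : R => 'D_v f (s *: v + x)) 0 1.
  by apply/(derivable_line ('D_v f) x v 0); rewrite scale0r add0r.
rewrite leNgt; apply/negP => gpos.
have [|t /fle] := increase_of_second_derivative_gt0 r0 dh g0 dg.
  by rewrite (derive_line ('D_v f) x v 0) scale0r add0r.
by rewrite leNgt => /negP.
Qed.

End SecondDerivativeTest.

(** * A pointwise calculus for the Laplacian *)

Section Laplacian.
Context {R : realType} {k : nat}.
Implicit Types (A : set 'rV[R]_k) (f g l : 'rV[R]_k -> R).

(** Pure second partial derivatives along the coordinate lines are exactly the
    regularity that the second derivative test uses. *)
Definition is_laplacian A f l : Prop := forall x, A x ->
  [/\ forall i, derivable f x 'e_i,
      forall i, derivable (partial i f) x 'e_i & laplacian f x = l x].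

(** Derivative formulas valid on an open set can be differentiated again: near each
    point the partial derivative agrees with its formula. *)
Lemma is_laplacian_of_partials A f (df ddf : 'I_k -> 'rV[R]_k -> R) : open A ->
  (forall x i, A x -> is_derive x 'e_i f (df i x)) ->
  (forall x i, A x -> is_derive x 'e_i (df i) (ddf i x)) ->
  is_laplacian A f (fun x => \sum_i ddf i x).
Proof.
move=> oA Hdf Hddf x Ax.
have eq_df i : \near x, df i x = partial i f x.
  near=> y; have Ay : A y by near: y; exact: open_nbhs_nbhs.
  by have [_ <-] := Hdf y i Ay.
have Hp i : is_derive x 'e_i (partial i f) (ddf i x).
  by apply: near_eq_is_derive (eq_df i) _; exact: Hddf.
split=> [i|i|].
- by have [] := Hdf x i Ax.
- by have [] := Hp i.
- by apply: eq_bigr => i _; have [_] := Hp i.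
Unshelve. all: by end_near. Qed.

Lemma is_laplacianE A f l x : is_laplacian A f l -> A x -> laplacian f x = l x.
Proof. by move=> H /H[]. Qed.

Lemma is_laplacian_partial A f l x i : is_laplacian A f l -> A x ->
  is_derive x 'e_i f (partial i f x).
Proof. by move=> H /H[d _ _]; apply: DeriveDef. Qed.

Lemma is_laplacian_partial_partial A f l x i : is_laplacian A f l -> A x ->
  is_derive x 'e_i (partial i f) (partial i (partial i f) x).
Proof. by move=> H /H[_ d _]; apply: DeriveDef. Qed.

Lemma eq_is_laplacian A f l l' : (forall x, A x -> l x = l' x) ->
  is_laplacian A f l -> is_laplacian A f l'.
Proof. by move=> e H x Ax; have [? ? ?] := H x Ax; split=> //; rewrite -e. Qed.

Lemma is_laplacian_sub A B f l : B `<=` A ->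
  is_laplacian A f l -> is_laplacian B f l.
Proof. by move=> BA H x /BA/H. Qed.

Lemma is_laplacianD A f g l h : open A ->
  is_laplacian A f l -> is_laplacian A g h ->
  is_laplacian A (fun x => f x + g x) (fun x => l x + h x).
Proof.
move=> oA Hf Hg; apply: eq_is_laplacian; last first.
- apply: (@is_laplacian_of_partials A _ (fun i x => partial i f x + partial i g x)
   (fun i x => partial i (partial i f) x + partial i (partial i g) x)) => // x i Ax.
  + by apply: is_deriveD; apply: is_laplacian_partial Ax; eassumption.
  + by apply: is_deriveD; apply: is_laplacian_partial_partial Ax; eassumption.
- by move=> x Ax; rewrite /= big_split -(is_laplacianE Hf Ax) -(is_laplacianE Hg Ax).
Qed.

Lemma is_laplacianZ A f l (c : R) : open A -> is_laplacian A f l ->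
  is_laplacian A (fun x => c * f x) (fun x => c * l x).
Proof.
move=> oA Hf; apply: eq_is_laplacian; last first.
- apply: (@is_laplacian_of_partials A _ (fun i x => c * partial i f x)
   (fun i x => c * partial i (partial i f) x)) => // x i Ax.
  + by apply: is_deriveZ; apply: is_laplacian_partial Ax; eassumption.
  + by apply: is_deriveZ; apply: is_laplacian_partial_partial Ax; eassumption.
- by move=> x Ax; rewrite /= -mulr_sumr -(is_laplacianE Hf Ax).
Qed.

Lemma is_laplacian_cst A (c : R) : is_laplacian A (fun=> c) (fun=> 0).
Proof.
have p0 i : partial i (fun=> c) = fun=> 0 :> R.
  by apply/funext => y; exact: derive_cst.
move=> x _; split=> [i|i|]; first exact: derivable_cst.
- by rewrite p0; exact: derivable_cst.
- by apply: big1 => i _; rewrite p0; exact: derive_cst.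
Qed.

Lemma is_laplacian_sum A (I : eqType) (r : seq I) (f l : I -> 'rV[R]_k -> R) :
  open A -> (forall i, i \in r -> is_laplacian A (f i) (l i)) ->
  is_laplacian A (fun x => \sum_(i <- r) f i x) (fun x => \sum_(i <- r) l i x).
Proof.
move=> oA; elim: r => [|i r IHr] H.
  have e (h : I -> 'rV[R]_k -> R) : (fun x => \sum_(i <- [::]) h i x) = fun=> 0.
    by apply/funext => x; rewrite big_nil.
  by rewrite !e; exact: is_laplacian_cst.
have e (h : I -> 'rV[R]_k -> R) : (fun x => \sum_(i <- i :: r) h i x) =
    (fun x => h i x + \sum_(i <- r) h i x).
  by apply/funext => x; rewrite big_cons.
rewrite !e; apply: is_laplacianD => //; first by apply: H; exact: mem_head.
by apply: IHr => i' i'r; apply: H; rewrite in_cons i'r orbT.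
Qed.

End Laplacian.

(** The map [xprime] is linear and so preserves the difference quotients; with
    [xlast] this gives the derivatives of the products f(x') x_n^n, which are the
    building blocks of the profiles. *)
Section Columns.
Context {R : realType} {k : nat}.
Implicit Types (x v : 'rV[R]_k.+1) (f : 'rV[R]_k -> R).

Lemma xprimeD x v : xprime (x + v) = xprime x + xprime v.
Proof. by apply/rowP => i; rewrite !mxE. Qed.

Lemma xprimeZ (t : R) x : xprime (t *: x) = t *: xprime x.
Proof. by apply/rowP => i; rewrite !mxE. Qed.

Lemma is_derive_xprime f x v (df : R) :
  is_derive (xprime x) (xprime v) f df -> is_derive x v (f \o @xprime R k) df.
Proof.
have e : (fun h : R => h^-1 *: (((f \o @xprime R k) \o shift x) (h *: v)
                 - (f \o @xprime R k) x)) =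
   (fun h : R => h^-1 *: ((f \o shift (xprime x)) (h *: xprime v)
                 - f (xprime x))).
  by apply/funext => h /=; rewrite xprimeD xprimeZ.
by case=> d <-; apply: DeriveDef; rewrite /derivable /derive e.
Qed.

Lemma is_derive_xlast x v : is_derive x v (@xlast R k) (xlast v).
Proof.
have e : (fun h : R => h^-1 *: ((@xlast R k \o shift x) (h *: v) - xlast x)) @ 0^'
    --> xlast v.
  apply: cvg_near_cst; near=> h; rewrite /= /xlast !mxE addrK.
  rewrite /GRing.scale /= mulKf//.
  by near: h; exact: nbhs_dnbhs_neq.
apply: DeriveDef; first by apply/cvg_ex; exists (xlast v).
exact/cvg_lim.
Unshelve. all: by end_near. Qed.

Lemma xprime_lift (j : 'I_k) : xprime 'e_(lift ord_max j) = 'e_j :> 'rV[R]_k.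
Proof.
by apply/rowP => i; rewrite !mxE (inj_eq lift_inj).
Qed.

Lemma xprime_max : xprime 'e_ord_max = 0 :> 'rV[R]_k.
Proof. by apply/rowP => i; rewrite !mxE eq_sym (negPf (neq_lift _ _)) andbF. Qed.

Lemma xlast_lift (j : 'I_k) : xlast ('e_(lift ord_max j) : 'rV[R]_k.+1) = 0.
Proof. by rewrite /xlast !mxE eqxx (negPf (neq_lift _ _)). Qed.

Lemma xlast_max : xlast ('e_ord_max : 'rV[R]_k.+1) = 1.
Proof. by rewrite /xlast !mxE !eqxx. Qed.

Lemma xprime_continuous : continuous (@xprime R k).
Proof.
move=> x s /nbhs_ballP[e /= e0 es]; apply/nbhs_ballP; exists e => //= y [_ xy].
by apply: es; split=> // i j; rewrite !mxE; exact: xy.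
Qed.

Lemma xlast_continuous : continuous (@xlast R k).
Proof. exact: coord_continuous. Qed.

Lemma is_derive_xmono f x v (df : R) n :
  is_derive (xprime x) (xprime v) f df ->
  is_derive x v (fun y => f (xprime y) * xlast y ^+ n)
   (df * xlast x ^+ n + f (xprime x) * (n%:R * xlast x ^+ n.-1 * xlast v)).
Proof.
move=> /is_derive_xprime Hf.
have Hn := @is_deriveX R _ _ n x v _ (is_derive_xlast x v).
have := @is_deriveM R _ _ _ x v _ _ Hf Hn.
rewrite exprfctE => H; apply: is_derive_eq H _.
by rewrite /GRing.scale /= addrC; congr (_ + _); rewrite mulrC.
Qed.

Lemma is_laplacian_xmono (w : set 'rV[R]_k) (f l : 'rV[R]_k -> R) n : open w ->
  is_laplacian w f l ->
  is_laplacian (@xprime R k @^-1` w) (fun x => f (xprime x) * xlast x ^+ n)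
   (fun x => l (xprime x) * xlast x ^+ n
     + f (xprime x) * ((n * n.-1)%:R * xlast x ^+ n.-2)).
Proof.
move=> ow Hf.
have ow' : open (@xprime R k @^-1` w).
  by apply: open_comp ow => x _; exact: xprime_continuous.
pose df (i : 'I_k.+1) (y : 'rV[R]_k.+1) : R :=
  if unlift ord_max i is Some j then partial j f (xprime y) * xlast y ^+ n
  else f (xprime y) * (n%:R * xlast y ^+ n.-1).
pose ddf (i : 'I_k.+1) (y : 'rV[R]_k.+1) : R :=
  if unlift ord_max i is Some j
  then partial j (partial j f) (xprime y) * xlast y ^+ n
  else f (xprime y) * ((n * n.-1)%:R * xlast y ^+ n.-2).
apply: eq_is_laplacian; last first.
- apply: (@is_laplacian_of_partials _ _ _ _ df ddf) => // x i wx.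
  + rewrite /df; case: unliftP => [j ->|->].
    * have := @is_derive_xmono f x 'e_(lift ord_max j) _ n.
      rewrite xprime_lift xlast_lift => /(_ _ (is_laplacian_partial _ Hf wx)).
      by rewrite !mulr0 addr0.
    * have := @is_derive_xmono f x 'e_ord_max _ n.
      rewrite xprime_max xlast_max => /(_ _ (is_derive0 _ _)).
      by rewrite mul0r add0r mulr1.
  + rewrite /df /ddf; case: unliftP => [j ->|->].
    * have := @is_derive_xmono (partial j f) x 'e_(lift ord_max j) _ n.
      rewrite xprime_lift xlast_lift => /(_ _ (is_laplacian_partial_partial _ Hf wx)).
      by rewrite !mulr0 addr0.
    * have := @is_derive_xmono (fun y => n%:R * f y) x 'e_ord_max _ n.-1.
      rewrite xprime_max xlast_max => /(_ _ (is_derive0 _ _)).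
      rewrite mul0r add0r mulr1 natrM.
      have -> : (fun y : 'rV[R]_k.+1 => n%:R * f (xprime y) * xlast y ^+ n.-1) =
        (fun y => f (xprime y) * (n%:R * xlast y ^+ n.-1)).
        by apply/funext => y; rewrite -mulrA mulrCA.
      move=> H; apply: is_derive_eq H _.
      by rewrite -!mulrA mulrCA.
- move=> x wx; rewrite /= (bigD1_ord ord_max)//= /ddf unlift_none addrC; congr (_ + _).
  under eq_bigr do rewrite liftK.
  by rewrite -mulr_suml -(is_laplacianE Hf wx).
Qed.

End Columns.

(** Needed because the extension of the expansion coincides with the expansion only
    on the thin domain. *)
Lemma near_is_laplacian {R : realType} {k : nat} (A : set 'rV[R]_k)
    (f g l : 'rV[R]_k -> R) : open A -> (forall x, A x -> f x = g x) ->
  is_laplacian A f l -> is_laplacian A g l.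
Proof.
move=> oA fg Hf; have eqfg x : A x -> \near x, f x = g x.
  move=> Ax; near=> y; apply: fg; near: y; exact: open_nbhs_nbhs.
apply: eq_is_laplacian; last first.
- apply: (@is_laplacian_of_partials _ _ A g (fun i => partial i f)
    (fun i => partial i (partial i f))) => // x i Ax.
    by apply: near_eq_is_derive (eqfg _ Ax) (is_laplacian_partial i Hf Ax).
  exact: is_laplacian_partial_partial Hf Ax.
- by move=> x Ax; rewrite -(is_laplacianE Hf Ax).
Unshelve. all: by end_near. Qed.

Lemma is_laplacian_xmono_scaled {R : realType} {k : nat} (w : set 'rV[R]_k)
    (f l : 'rV[R]_k -> R) (e : R) n : open w -> e != 0 -> is_laplacian w f l ->
  is_laplacian (@xprime R k @^-1` w) (fun x => f (xprime x) * (xlast x / e) ^+ n)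
   (fun x => l (xprime x) * (xlast x / e) ^+ n
     + e ^- 2 * (f (xprime x) * ((n * n.-1)%:R * (xlast x / e) ^+ n.-2))).
Proof.
move=> ow e0 Hf; have oW : open (@xprime R k @^-1` w).
  by apply: open_comp ow => x _; exact: xprime_continuous.
have := is_laplacianZ (e ^- n) oW (is_laplacian_xmono n ow Hf).
have -> : (fun x : 'rV[R]_k.+1 => e ^- n * (f (xprime x) * xlast x ^+ n)) =
    fun x => f (xprime x) * (xlast x / e) ^+ n.
  by apply/funext => x; rewrite expr_div_n mulrC -mulrA.
apply: eq_is_laplacian => x wx; rewrite mulrDr; congr (_ + _).
  by rewrite expr_div_n mulrC -mulrA.
(* For n < 2 the coefficient n (n - 1) cancels the truncated exponent. *)
case: n => [|[|n]]; rewrite ?mul0n ?muln0 ?mul0r ?mulr0//=.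
rewrite expr_div_n -addn2 exprD invfM.
set c := (_ * _)%:R; move: c => c.
by move: (e ^- n) (e ^- 2) (xlast x ^+ n) (f _) => a b X F; ring.
Qed.

(** * Continuity up to the closure *)

Lemma compact_closure_bounded {R : realType} {k : nat} (A : set 'rV[R]_k) :
  bounded_set A -> compact (closure A).
Proof.
move=> [M [Mreal AM]]; apply: bounded_closed_compact; last exact: closed_closure.
exists M; split=> // M' MM' x /= cAx.
have clM : closed [set y : 'rV[R]_k | `|y| <= M'].
  by apply: closed_comp (@closed_le _ M') => y _; exact: norm_continuous.
suff : [set y : 'rV[R]_k | `|y| <= M'] x by [].
by have /closure_id -> := clM; apply: closureS cAx; exact: AM.
Qed.

Section WithinClosure.
Context {R : realType} {T : topologicalType}.
Implicit Types (A : set T) (f g : T -> R).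

Lemma within_continuous_cst A (c : R) : {within A, continuous (fun=> c)}.
Proof. by move=> x; exact: cvg_cst. Qed.

Lemma within_continuousD A f g : {within A, continuous f} ->
  {within A, continuous g} -> {within A, continuous (fun x => f x + g x)}.
Proof. by move=> cf cg x; exact: cvgD (cf x) (cg x). Qed.

Lemma within_continuousM A f g : {within A, continuous f} ->
  {within A, continuous g} -> {within A, continuous (fun x => f x * g x)}.
Proof. by move=> cf cg x; exact: cvgM (cf x) (cg x). Qed.

Lemma within_continuousX A f n : {within A, continuous f} ->
  {within A, continuous (fun x => f x ^+ n)}.
Proof.
move=> cf; elim: n => [|n IHn].
  have -> : (fun x => f x ^+ 0) = fun=> 1 by apply/funext => x; rewrite expr0.
  exact: within_continuous_cst.
have -> : (fun x => f x ^+ n.+1) = fun x => f x * f x ^+ n.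
  by apply/funext => x; rewrite exprS.
exact: within_continuousM.
Qed.

Lemma within_continuous_sum A (I : eqType) (r : seq I) (f : I -> T -> R) :
  (forall i, i \in r -> {within A, continuous (f i)}) ->
  {within A, continuous (fun x => \sum_(i <- r) f i x)}.
Proof.
elim: r => [|i r IHr] cf.
  have -> : (fun x => \sum_(i <- [::]) f i x) = fun=> 0.
    by apply/funext => x; rewrite big_nil.
  exact: within_continuous_cst.
have -> : (fun x => \sum_(i <- i :: r) f i x) =
    (fun x => f i x + \sum_(i <- r) f i x).
  by apply/funext => x; rewrite big_cons.
apply: within_continuousD; first by apply: cf; exact: mem_head.
by apply: IHr => i' i'r; apply: cf; rewrite in_cons i'r orbT.
Qed.

Lemma within_closure_ge0 A f : {within closure A, continuous f} ->
  (forall x, A x -> 0 <= f x) -> forall x, closure A x -> 0 <= f x.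
Proof.
move=> /subspace_continuousP cf f_ge0 x cAx; rewrite leNgt; apply/negP => fx0.
have : within (closure A) (nbhs x) [set y | f y < 0].
  by have := cf x cAx; move/cvgr_lt; apply.
move=> /cAx[y [Ay]] /(_ (subset_closure Ay)) /=.
by rewrite ltNge f_ge0.
Qed.

(** A continuous extension inherits the identities that hold on the set; this is how
    the boundary values on the lateral part of the frontier are obtained. *)
Lemma within_closure_eq0 A f : {within closure A, continuous f} ->
  (forall x, A x -> f x = 0) -> forall x, closure A x -> f x = 0.
Proof.
move=> cf f0 x cAx; apply/le_anti/andP; split; last first.
  by apply: (within_closure_ge0 cf) cAx => y /f0->.
rewrite -oppr_ge0; apply: (@within_closure_ge0 A (fun x => - f x)) cAx.
  by move=> y; exact: cvgN (cf y).
by move=> y /f0->; rewrite oppr0.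
Qed.

Lemma within_closure_bounded A f : compact (closure A) ->
  {within closure A, continuous f} ->
  exists M, forall x, closure A x -> `|f x| <= M.
Proof.
move=> cA cf; have /compact_bounded[M [_ fM]] := continuous_compact cf cA.
exists (M + 1) => x cAx; apply: (fM (M + 1)); first by rewrite ltrDl.
by exists x.
Qed.

Lemma within_comp {T' : topologicalType} (A : set T) (B : set T')
    (phi : T -> T') (f : T' -> R) : continuous phi -> (forall x, A x -> B (phi x)) ->
  {within B, continuous f} -> {within A, continuous (f \o phi)}.
Proof.
move=> cphi AB /subspace_continuousP cf; apply/subspace_continuousP => x Ax.
apply: cvg_comp (cf _ (AB _ Ax)) => U /= BU.
have : nbhs x (phi @^-1` [set y | B y -> U y]) by exact: cphi.
by apply: filterS => y /= H Ay; apply/H/AB.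
Qed.

End WithinClosure.

Lemma mem_closure_comp {T T' : topologicalType} (A : set T) (B : set T')
    (phi : T -> T') : continuous phi -> (forall x, A x -> B (phi x)) ->
  forall x, closure A x -> closure B (phi x).
Proof.
move=> cphi AB x cAx U /cphi /cAx[y [Ay Uy]]; exists (phi y); split=> //; exact: AB.
Qed.

(** * The maximum principle in a slab *)

Lemma is_laplacian_le0_at_max {R : realType} {k : nat} (A : set 'rV[R]_k)
    (f l : 'rV[R]_k -> R) (x : 'rV[R]_k) : open A -> is_laplacian A f l ->
  A x -> (forall y, A y -> f y <= f x) -> l x <= 0.
Proof.
move=> oA Hf Ax fmax; have [_ ddf <-] := Hf x Ax.
apply: sumr_le0 => i _; apply: (second_derivative_test oA Ax _ (ddf i) fmax) => y Ay.
by have [] := Hf y Ay.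
Qed.

(** At a maximum inside [A] no second partial derivative is positive, so a positive
    Laplacian forces the maximum to the frontier. *)
Lemma strict_maximum_principle {R : realType} {k : nat} (A : set 'rV[R]_k)
    (f l : 'rV[R]_k -> R) : open A -> bounded_set A -> is_laplacian A f l ->
  {within closure A, continuous f} -> (forall x, A x -> 0 < l x) ->
  (forall x, frontier A x -> f x <= 0) -> forall x, closure A x -> f x <= 0.
Proof.
move=> oA bA Hf cf lpos f_le0 x cAx.
have [c /set_mem cAc fmax] :=
  compact_EVT_max (ex_intro _ x cAx) (compact_closure_bounded bA) cf.
apply: le_trans (fmax x (mem_set cAx)) _.
have [Ac|nAc] := pselect (A c); last first.
  by apply: f_le0; split=> // /interior_subset.
have := lpos _ Ac; rewrite ltNge => /negP[]; apply: is_laplacian_le0_at_max Hf Ac _ => //.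
by move=> y /subset_closure/mem_set/fmax.
Qed.

(** The barrier K (L^2 - x_n^2) / 2 has Laplacian - K and is nonnegative on the
    closure of [A], so it dominates both [f] and [- f].  The bound is quadratic in
    the width of the slab, whatever the extent of [A] in the other directions. *)
Lemma slab_estimate {R : realType} {k : nat} (A : set 'rV[R]_k.+1)
    (f l : 'rV[R]_k.+1 -> R) (K L : R) : open A -> bounded_set A ->
  is_laplacian A f l -> {within closure A, continuous f} ->
  (forall x, A x -> `|xlast x| <= L) -> (forall x, A x -> `|l x| < K) ->
  (forall x, frontier A x -> f x = 0) ->
  forall x, closure A x -> `|f x| <= K * L ^+ 2.
Proof.
move=> oA bA.
have main (f' l' : 'rV[R]_k.+1 -> R) :
    is_laplacian A f' l' -> {within closure A, continuous f'} ->
    (forall x, A x -> `|xlast x| <= L) -> (forall x, A x -> `|l' x| < K) ->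
    (forall x, frontier A x -> f' x = 0) ->
    forall x, closure A x -> f' x <= K * L ^+ 2.
  move=> Hf cf AL lK f0 x cAx.
  have K0 : 0 <= K.
    have [y [Ay _]] := cAx setT filterT.
    exact: le_trans (normr_ge0 _) (ltW (lK y Ay)).
  have cx : {within closure A, continuous (fun y : 'rV[R]_k.+1 => xlast y ^+ 2)}.
    apply: within_continuousX; apply: continuous_subspaceT; exact: xlast_continuous.
  have xL y : closure A y -> xlast y ^+ 2 <= L ^+ 2.
    move=> cAy; rewrite -subr_ge0 -mulN1r.
    apply: (@within_closure_ge0 R _ A (fun y => L ^+ 2 + -1 * xlast y ^+ 2)) cAy.
      apply: within_continuousD; first exact: within_continuous_cst.
      by apply: within_continuousM cx; exact: within_continuous_cst.
    move=> z /AL zL; rewrite mulN1r subr_ge0 -(real_normK (num_real (xlast z))).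
    by rewrite ler_sqr ?nnegrE// (le_trans _ zL).
  have Hx : is_laplacian A (fun y => 1 * xlast y ^+ 2)
      (fun y => 0 * xlast y ^+ 2 + 1 * ((2 * 1)%:R * xlast y ^+ 0)).
    apply: (@is_laplacian_sub _ _ (@xprime R k @^-1` setT)) => //.
    apply: (@is_laplacian_xmono R k setT (fun=> 1) (fun=> 0) 2) => //.
      exact: openT.
    exact: is_laplacian_cst.
  have Hphi := is_laplacianD oA (is_laplacianD oA Hf
    (is_laplacianZ (K / 2) oA Hx)) (@is_laplacian_cst R _ A (- (K / 2 * L ^+ 2))).
  (* The strict bound on the Laplacian makes that of f' minus the barrier > 0. *)
  have := strict_maximum_principle oA bA Hphi _ _ _ cAx.
  have phi_le y : f' y <= 0 -> closure A y ->
      f' y + K / 2 * (1 * xlast y ^+ 2) - K / 2 * L ^+ 2 <= 0.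
    by move=> fy /xL; nra.
  move=> H; have {H} : f' x + K / 2 * (1 * xlast x ^+ 2) - K / 2 * L ^+ 2 <= 0.
    apply: H.
    - apply: within_continuousD; last exact: within_continuous_cst.
      apply: within_continuousD cf _; apply: within_continuousM.
        exact: within_continuous_cst.
      by apply: within_continuousM cx; exact: within_continuous_cst.
    - by move=> y /lK; rewrite ltr_norml => /andP[? _]; rewrite expr0; nra.
    - by move=> y fy; apply: phi_le; [rewrite f0|case: fy].
  have := sqr_ge0 (xlast x); have := sqr_ge0 L; nra.
move=> Hf cf AL lK f0 x cAx; rewrite ler_norml; apply/andP; split; last first.
  exact: main Hf _ _ _ _ _ _.
rewrite lerNl -mulN1r.
apply: (main _ _ (is_laplacianZ (-1) oA Hf)) => //.
- by apply: within_continuousM cf; exact: within_continuous_cst.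
- by move=> y /lK; rewrite mulN1r normrN.
- by move=> y /f0->; rewrite mulr0.
Qed.

(** * Geometry of the thin domain *)

Section ThinDomain.
Context {R : realType} {k : nat} (w : set 'rV[R]_k) (hp hm : 'rV[R]_k -> R).
Hypotheses (ow : open w) (hp_cont : {within closure w, continuous hp})
  (hm_cont : {within closure w, continuous hm}).
Variable e : R.
Local Notation T := (thin_domain w hp hm e).

Let prime_T x : closure T x -> closure w (xprime x).
Proof. by apply: mem_closure_comp => [|y []//]; exact: xprime_continuous. Qed.

Lemma within_closure_thin (g : 'rV[R]_k -> R) : {within closure w, continuous g} ->
  {within closure T, continuous (fun x => g (xprime x))}.
Proof. by apply: (within_comp (@xprime_continuous R k)); exact: prime_T. Qed.

Let slab_cont (g : 'rV[R]_k -> R) (a b : R) : {within closure w, continuous g} ->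
  {within closure T, continuous (fun x => a * g (xprime x) + b * xlast x)}.
Proof.
move=> cg; apply: within_continuousD; apply: within_continuousM.
- exact: within_continuous_cst.
- exact: within_closure_thin.
- exact: within_continuous_cst.
- by apply: continuous_subspaceT; exact: xlast_continuous.
Qed.

Lemma closure_thin_domain x : closure T x ->
  closure w (xprime x) /\ - (e * hm (xprime x)) <= xlast x <= e * hp (xprime x).
Proof.
move=> cTx; split; first exact: prime_T.
have H1 y : T y -> 0 <= e * hm (xprime y) + 1 * xlast y.
  by move=> [_ /andP[+ _]]; rewrite -subr_gt0 mul1r opprK addrC => /ltW.
have H2 y : T y -> 0 <= e * hp (xprime y) + -1 * xlast y.
  by move=> [_ /andP[_]]; rewrite -subr_gt0 mulN1r => /ltW.
have := within_closure_ge0 (@slab_cont hm e 1 hm_cont) H1 cTx.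
have := within_closure_ge0 (@slab_cont hp e (-1) hp_cont) H2 cTx.
by move=> ? ?; apply/andP; split; lra.
Qed.

Lemma open_thin_domain : open T.
Proof.
have in_w (h : 'rV[R]_k -> R) : {within closure w, continuous h} -> {in w, continuous h}.
  move=> ch; rewrite -(continuous_open_subspace h ow).
  exact: continuous_subspaceW (@subset_closure _ w) ch.
have pos (h : 'rV[R]_k -> R) (a b : R) x : {within closure w, continuous h} ->
    w (xprime x) -> 0 < a * h (xprime x) + b * xlast x ->
    \forall y \near x, 0 < a * h (xprime y) + b * xlast y.
  move=> ch wx ah0.
  have cx : (fun y => h (xprime y)) @ x --> h (xprime x).
    apply: (@cvg_comp _ _ _ (@xprime R k) h); first exact: xprime_continuous.
    by apply: in_w => //; rewrite inE.
  have : (fun y => a * h (xprime y) + b * xlast y) @ x -->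
      a * h (xprime x) + b * xlast x.
    exact: cvgD (cvgM (cvg_cst a) cx) (cvgM (cvg_cst b) (@xlast_continuous R k x)).
  by move/cvgr_gt; apply.
rewrite openE => x [wx /andP[]]; rewrite -subr_gt0 opprK addrC -[xlast x]mul1r => h1.
rewrite mul1r -subr_gt0 -mulN1r => h2.
have oW : nbhs x (@xprime R k @^-1` w).
  by apply: xprime_continuous; exact: open_nbhs_nbhs.
near=> y; split.
  by near: y.
apply/andP; split; rewrite -subr_gt0.
- rewrite opprK addrC -[xlast y]mul1r; near: y; exact: pos.
- rewrite -mulN1r; near: y; exact: pos.
Unshelve. all: by end_near. Qed.

(** Over the frontier of [w] the interval of admissible [xlast x] degenerates to one
    point, so the two graphs cover the frontier entirely. *)
Lemma frontier_thin_domain x : (forall y, frontier w y -> hm y + hp y = 0) ->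
  frontier T x ->
  closure w (xprime x) /\
  (xlast x = e * hp (xprime x) \/ xlast x = - (e * hm (xprime x))).
Proof.
move=> H0 [cTx]; rewrite (interior_id _).1; last exact: open_thin_domain.
have [cwx /andP[le1 le2]] := closure_thin_domain cTx => nTx; split=> //.
have [wx|nwx] := pselect (w (xprime x)).
  have [l1|ne1] := eqVneq (xlast x) (e * hp (xprime x)); first by left.
  have [l2|ne2] := eqVneq (xlast x) (- (e * hm (xprime x))); first by right.
  by case: nTx; split=> //; rewrite !lt_neqAle le1 le2 ne1 eq_sym ne2.
have /H0 hE : frontier w (xprime x).
  by split=> //; rewrite (interior_id _).1.
left; apply/le_anti; rewrite le2 (_ : e * hp _ = - (e * hm (xprime x)))//.
by rewrite -mulrN; congr (_ * _); lra.
Qed.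

Lemma thin_domain_xlast_le (M : R) x : 0 <= e ->
  (forall y, w y -> `|hp y| <= M) -> (forall y, w y -> `|hm y| <= M) ->
  T x -> `|xlast x| <= e * M.
Proof.
move=> e0 hpM hmM [/[dup] /hpM + /hmM]; rewrite !ler_norml => /andP[_ pM] /andP[_ mM].
move=> /andP[/ltW l1 /ltW l2]; apply/andP; split.
  by apply: le_trans l1; rewrite lerN2 ler_wpM2l.
by apply: le_trans l2 _; rewrite ler_wpM2l.
Qed.

Lemma bounded_thin_domain (M : R) : bounded_set w -> (forall x, T x -> `|xlast x| <= M) ->
  bounded_set T.
Proof.
move=> [B [Breal wB]] xM; exists (Num.max B M); split=> // [|M' BM x Tx].
  exact: num_real.
have [wx _] := Tx.
move: BM; rewrite gt_max => /andP[BM MM].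
have M'0 : 0 <= M' by apply: le_trans (ltW MM); apply: le_trans (xM _ Tx).
have xM' : `|xprime x| <= M' by exact: wB.
rewrite /= [`|x|]mx_normrE; apply: bigmax_le => //= -[i j] _ /=.
rewrite (ord1 i); case: (unliftP ord_max j) => [j' ->|->].
  apply: le_trans xM'; rewrite [`|xprime x|]mx_normrE.
  by apply: le_trans (le_bigmax _ _ (0, j')); rewrite /= !mxE.
by apply: le_trans (ltW MM); exact: xM.
Qed.

End ThinDomain.

(** * Algebra of the profiles *)

Lemma big_nat_split2 (V : nmodType) (F : nat -> V) n : (1 < n)%N ->
  \sum_(0 <= i < n) F i = F 0%N + F 1%N + \sum_(2 <= i < n) F i.
Proof.
by move=> n1; rewrite (big_cat_nat (n := 2))//= big_nat_recr//= big_nat1.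
Qed.

Section CoefficientAlgebra.
Context {R : realType} {k : nat}.
Variables hp hm : 'rV[R]_k -> R.
Local Notation al := (alpha hp hm).
Local Notation a x := (hp x).
Local Notation b x := (- hm x).

Lemma alpha_rec j i : (0 < j)%N -> (2 <= i < 2 * j.+1)%N ->
  al j.+1 i = fun x => - (i * i.-1)%N%:R^-1 * laplacian (al j (i - 2)%N) x.
Proof.
case: j => // j _ /andP[i2 ij].
by case: i i2 ij => [|[|i]] // _ ij; apply/funext => x; rewrite /= ij.
Qed.

Lemma alpha1E j x : (0 < j)%N -> al j.+1 1%N x =
  - \sum_(2 <= l < 2 * j.+1) al j.+1 l x *
      \sum_(0 <= m < l) hp x ^+ m * (- hm x) ^+ (l - m - 1).
Proof.
case: j => // j _; rewrite [LHS]/=; congr (- _).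
by apply: eq_big_nat => l lj; rewrite (alpha_rec _ lj).
Qed.

Lemma alpha0E j x : (0 < j)%N -> al j.+1 0%N x =
  \sum_(2 <= l < 2 * j.+1) al j.+1 l x *
      \sum_(1 <= m < l) hp x ^+ m * (- hm x) ^+ (l - m).
Proof.
case: j => // j _; rewrite [LHS]/=.
by apply: eq_big_nat => l lj; rewrite (alpha_rec _ lj).
Qed.

Lemma alpha_topS j : (0 < j)%N -> (alpha_top j.+1).+1 = (2 * j.+1)%N.
Proof. by case: j => // j _; rewrite /alpha_top /= mulnS. Qed.

Lemma profileSE j x xi : (0 < j)%N -> profile hp hm j.+1 x xi =
  al j.+1 0%N x + al j.+1 1%N x * xi + \sum_(2 <= l < 2 * j.+1) al j.+1 l x * xi ^+ l.
Proof.
move=> j0; rewrite /profile alpha_topS//.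
by rewrite big_nat_split2 ?mulnS// expr0 mulr1 expr1.
Qed.

(** The polynomial xi^l - S1 xi + S0 is the remainder of the linear interpolation of
    xi^l at A and B: S1 = (A^l - B^l) / (A - B) is the slope, written without
    division so that A = B is allowed. *)
Let interp_remainder_fst (A B : R) l : (2 <= l)%N ->
  A ^+ l - (\sum_(0 <= m < l) A ^+ m * B ^+ (l - m - 1)) * A
    + \sum_(1 <= m < l) A ^+ m * B ^+ (l - m) = 0.
Proof.
case: l => // l l2; rewrite big_nat_recr//= subSnn subnn expr0 mulr1 mulrDl mulr_suml.
rewrite -exprSr [X in _ - (X + _) + _](_ : _ = \sum_(1 <= m < l.+1) A ^+ m * B ^+ (l.+1 - m)).
  by ring.
rewrite big_add1 /=; apply: eq_big_nat => m /andP[_ ml].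
by rewrite -mulrA mulrC -mulrA [_ * (_ ^+ m)]mulrC -exprSr mulrC subSS subnAC subn1.
Qed.

Let interp_remainder_snd (A B : R) l : (2 <= l)%N ->
  B ^+ l - (\sum_(0 <= m < l) A ^+ m * B ^+ (l - m - 1)) * B
    + \sum_(1 <= m < l) A ^+ m * B ^+ (l - m) = 0.
Proof.
move=> l2; rewrite big_ltn ?(ltnW l2)// expr0 mul1r subn0 mulrDl mulr_suml -exprSr.
rewrite subn1 prednK ?(ltnW l2)//.
rewrite [X in _ - (_ + X) + _](_ : _ = \sum_(1 <= m < l) A ^+ m * B ^+ (l - m)).
  by ring.
apply: eq_big_nat => m /andP[_ ml].
by rewrite -mulrA -exprSr subn1 prednK ?subn_gt0.
Qed.

(** For j >= 2 the profile is a combination of the interpolation remainders of the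
    powers xi^l with l >= 2. *)
Lemma profile_boundary j x xi : (0 < j)%N ->
  xi = hp x \/ xi = - hm x -> profile hp hm j x xi = 0.
Proof.
case: j => [//|[|j]] _ hxi.
  rewrite /profile /alpha_top /= !big_nat_recr//= big_geq// /hprod /hdiff.
  by case: hxi => ->; ring.
rewrite profileSE// alpha0E// alpha1E// mulNr mulr_suml -sumrN -!big_split /=.
apply: big1_seq => l /=; rewrite mem_index_iota => /andP[l2 _].
rewrite -mulrA -mulrN -!mulrDr.
suff -> : (\sum_(1 <= m < l) hp x ^+ m * (- hm x) ^+ (l - m) +
  - ((\sum_(0 <= m < l) hp x ^+ m * (- hm x) ^+ (l - m - 1)) * xi) + xi ^+ l) = 0.
  by rewrite mulr0.
rewrite -addrA addrC [X in X + _]addrC.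
by case: hxi => ->; [exact: interp_remainder_fst|exact: interp_remainder_snd].
Qed.

Definition profile_laplacian j x xi : R :=
  \sum_(0 <= i < (alpha_top j).+1) laplacian (al j i) x * xi ^+ i.

(** The second derivative of the profile with respect to [xi]. *)
Definition profile_xi2 j x xi : R :=
  \sum_(0 <= i < (alpha_top j).+1) al j i x * ((i * i.-1)%:R * xi ^+ i.-2).

Lemma profile_xi2_1 x xi : profile_xi2 1 x xi = -2.
Proof.
rewrite /profile_xi2 /alpha_top /= !big_nat_recr//= big_geq//.
by rewrite /hprod /hdiff expr0; ring.
Qed.

(** For j = 1 the profile has degree 2 = 2 j instead of 2 j - 1, but its leading
    coefficient is constant and drops out, so the range is uniform in j. *)
Lemma profile_laplacianE j x xi : (0 < j)%N ->
  profile_laplacian j x xi = \sum_(0 <= i < 2 * j) laplacian (al j i) x * xi ^+ i.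
Proof.
case: j => [//|[|j]] _; last by rewrite /profile_laplacian alpha_topS.
rewrite /profile_laplacian /alpha_top /= big_nat_recr//=.
rewrite (is_laplacianE (@is_laplacian_cst R k setT (-1)))//.
by rewrite mul0r addr0.
Qed.

(** The factor i (i - 1) from differentiating xi^i cancels the denominator in the
    recursion for the coefficients. *)
Lemma profile_xi2_rec j x xi : (0 < j)%N ->
  profile_xi2 j.+1 x xi = - profile_laplacian j x xi.
Proof.
move=> j0; rewrite profile_laplacianE// /profile_xi2 alpha_topS//.
rewrite big_nat_split2 ?mulnS// mul0n muln0 !mul0r !mulr0 !add0r.
rewrite -[X in \sum_(X <= _ < _) _](add0n 2%N) [(2 + 2 * j)%N]addnC big_addn addnK -sumrN.
apply: eq_big_nat => i /andP[_ ij].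
rewrite alpha_rec//; last by rewrite addn2 mulnS.
rewrite addnK addn2 /= -!mulrA mulNr; congr (- _).
rewrite mulrCA; congr (_ * _); by rewrite mulKf// pnatr_eq0 muln_eq0.
Qed.

End CoefficientAlgebra.

(** * Laplacian of the truncated expansion *)

Section ClosureRegularity.
Context {R : realType} {k : nat}.
Implicit Types (A : set 'rV[R]_k) (f : 'rV[R]_k -> R).

Lemma is_laplacian_Cn2 A f : Cn 2 A f -> is_laplacian A f (laplacian f).
Proof.
move=> [_ H] x Ax; split=> // i; have [df [_ ddf]] := H i; first exact: df.
by have [+ _] := ddf i; apply.
Qed.

Lemma is_laplacian_Cn_closure2 A f :
  Cn_closure 2 A f -> is_laplacian A f (laplacian f).
Proof.
move=> [_ H] x Ax; split=> // i; have [df [_ ddf]] := H i; first exact: df.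
by have [+ _] := ddf i; apply.
Qed.

Lemma bounded_sum (I : eqType) (r : seq I) (T : Type) (P : T -> Prop)
    (F : I -> T -> R) :
  (forall i, i \in r -> exists M, forall t, P t -> `|F i t| <= M) ->
  exists M, forall t, P t -> `|\sum_(i <- r) F i t| <= M.
Proof.
elim: r => [|i r IHr] H; first by exists 0 => t _; rewrite big_nil normr0.
have [M rM] : exists M, forall t, P t -> `|\sum_(i <- r) F i t| <= M.
  by apply: IHr => i' i'r; apply: H; rewrite in_cons i'r orbT.
have [B FB] := H i (mem_head _ _); exists (B + M) => t Pt.
by rewrite big_cons (le_trans (ler_normD _ _))// lerD ?FB ?rM.
Qed.

Lemma laplacian_bounded A f : compact (closure A) -> Cn_closure 2 A f ->
  exists M, forall x, A x -> `|laplacian f x| <= M.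
Proof.
move=> cA [_ H]; apply: bounded_sum => i _.
have [_ [_ H1]] := H i; have [_ [[g [cg gE]] _]] := H1 i.
have [M gM] := within_closure_bounded cA cg.
by exists M => x Ax; rewrite -gE//; apply/gM/subset_closure.
Qed.

End ClosureRegularity.

Section ExpansionLaplacian.
Context {R : realType} {k : nat} (w : set 'rV[R]_k) (hp hm : 'rV[R]_k -> R).
Variables (e : R).
Hypotheses (ow : open w) (e_neq0 : e != 0).
Local Notation al := (alpha hp hm).
Local Notation W := (@xprime R k @^-1` w).
Local Notation L := (profile_laplacian hp hm).

Let oW : open W.
Proof. by apply: open_comp ow => x _; exact: xprime_continuous. Qed.

Lemma is_laplacian_profile j :
  (forall i, (i <= alpha_top j)%N -> is_laplacian w (al j i) (laplacian (al j i))) ->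
  is_laplacian W (fun x => profile hp hm j (xprime x) (xlast x / e))
    (fun x => L j (xprime x) (xlast x / e)
              + e ^- 2 * profile_xi2 hp hm j (xprime x) (xlast x / e)).
Proof.
move=> H; rewrite /profile.
have -> : (fun x => L j (xprime x) (xlast x / e)
              + e ^- 2 * profile_xi2 hp hm j (xprime x) (xlast x / e)) =
  (fun x : 'rV[R]_k.+1 => \sum_(0 <= i < (alpha_top j).+1)
     (laplacian (al j i) (xprime x) * (xlast x / e) ^+ i +
      e ^- 2 * (al j i (xprime x) * ((i * i.-1)%:R * (xlast x / e) ^+ i.-2)))).
  by apply/funext => x; rewrite big_split/= -mulr_sumr.
apply: is_laplacian_sum => // i; rewrite mem_index_iota => /andP[_ ij].
exact: is_laplacian_xmono_scaled (H i ij).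
Qed.

(** The sum telescopes: the contribution of the second xi-derivative of each profile
    cancels the x'-Laplacian of the previous one. *)
Lemma is_laplacian_expansion N : (1 <= N)%N ->
  (forall j i, (1 <= j <= N)%N -> (i <= alpha_top j)%N ->
     is_laplacian w (al j i) (laplacian (al j i))) ->
  is_laplacian W (expansion hp hm N e)
    (fun x => -2 + e ^+ (2 * N) * L N (xprime x) (xlast x / e)).
Proof.
case: N => // N _; elim: N => [|N IHN] H.
  have H1 := is_laplacianZ (e ^+ 2) oW (is_laplacian_profile (H 1%N ^~ isT)).
  have -> : expansion hp hm 1 e =
      fun x => e ^+ 2 * profile hp hm 1 (xprime x) (xlast x / e).
    by apply/funext => x; rewrite /expansion big_nat1.
  apply: eq_is_laplacian H1 => x _.
  by rewrite profile_xi2_1 mulrDr mulrA divff ?expf_neq0// mul1r addrC.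
have -> : expansion hp hm N.+2 e = fun x => expansion hp hm N.+1 e x +
    e ^+ (2 * N.+2) * profile hp hm N.+2 (xprime x) (xlast x / e).
  by apply/funext => x; rewrite /expansion big_nat_recr.
have HN : is_laplacian W (expansion hp hm N.+1 e)
    (fun x => -2 + e ^+ (2 * N.+1) * L N.+1 (xprime x) (xlast x / e)).
  by apply: IHN => j i /andP[j0 jN]; apply: H; rewrite j0 (leq_trans jN).
have H1 := is_laplacianZ (e ^+ (2 * N.+2)) oW
  (is_laplacian_profile (fun i => H N.+2 i (leqnn _))).
apply: eq_is_laplacian (is_laplacianD oW HN H1) => x _.
rewrite profile_xi2_rec//.
have -> : e ^+ (2 * N.+2) = e ^+ 2 * e ^+ (2 * N.+1) by rewrite -exprD -mulnS.
have : e ^+ 2 * e ^- 2 = 1 by rewrite divff ?expf_neq0.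
move: (e ^+ (2 * N.+1)) (e ^+ 2) (e ^- 2) => E c d cd.
move: (L N.+1 _ _) (L N.+2 _ _) => l1 l2.
have -> : c * E * (l2 + d * - l1) = c * E * l2 - c * d * (E * l1) by ring.
by rewrite cd; ring.
Qed.

End ExpansionLaplacian.

(** * The first three profiles *)

Section ExplicitCoefficients.
Context {R : realType} {k : nat} (hp hm : 'rV[R]_k -> R).
Local Notation al := (alpha hp hm).
Local Notation d := (hdiff hp hm).
Local Notation p := (hprod hp hm).
Local Notation D := (@laplacian R k).

Let sum2_4 (F : nat -> R) : \sum_(2 <= l < 2 * 2) F l = F 2%N + F 3%N.
Proof. by rewrite -[(2 * 2)%N]/4%N big_nat_recr//= big_nat1. Qed.

Let sum2_6 (F : nat -> R) :
  \sum_(2 <= l < 2 * 3) F l = F 2%N + F 3%N + F 4%N + F 5%N.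
Proof. by rewrite -[(2 * 3)%N]/6%N 3?big_nat_recr//= big_nat1. Qed.

Let alpha2E i : (2 <= i < 4)%N ->
  al 2 i = fun x => - (i * i.-1)%:R^-1 * D (al 1 (i - 2)%N) x.
Proof. by move=> i_range; rewrite alpha_rec. Qed.

Let alpha3E i : (2 <= i < 6)%N ->
  al 3 i = fun x => - (i * i.-1)%:R^-1 * D (al 2 (i - 2)%N) x.
Proof. by move=> i_range; rewrite alpha_rec. Qed.

Let full_sums (A B : R) :
  [/\ \sum_(0 <= m < 2) A ^+ m * B ^+ (2 - m - 1) = A + B,
      \sum_(0 <= m < 3) A ^+ m * B ^+ (3 - m - 1) = A ^+ 2 + A * B + B ^+ 2,
      \sum_(0 <= m < 4) A ^+ m * B ^+ (4 - m - 1) =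
        A ^+ 3 + A ^+ 2 * B + A * B ^+ 2 + B ^+ 3 &
      \sum_(0 <= m < 5) A ^+ m * B ^+ (5 - m - 1) =
        A ^+ 4 + A ^+ 3 * B + A ^+ 2 * B ^+ 2 + A * B ^+ 3 + B ^+ 4].
Proof. by split; rewrite !big_nat_recr//= big_geq//; ring. Qed.

Let inner_sums (A B : R) :
  [/\ \sum_(1 <= m < 2) A ^+ m * B ^+ (2 - m) = A * B,
      \sum_(1 <= m < 3) A ^+ m * B ^+ (3 - m) = A ^+ 2 * B + A * B ^+ 2,
      \sum_(1 <= m < 4) A ^+ m * B ^+ (4 - m) =
        A ^+ 3 * B + A ^+ 2 * B ^+ 2 + A * B ^+ 3 &
      \sum_(1 <= m < 5) A ^+ m * B ^+ (5 - m) =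
        A ^+ 4 * B + A ^+ 3 * B ^+ 2 + A ^+ 2 * B ^+ 3 + A * B ^+ 4].
Proof. by split; rewrite ?[LHS]big_add1 /= !big_nat_recr//= big_geq//; ring. Qed.

Lemma profile1E x xi : profile hp hm 1 x xi = - xi ^+ 2 + xi * d x + p x.
Proof.
rewrite /profile !big_nat_recr//= big_geq//; ring.
Qed.

Lemma alpha2_2E : al 2 2%N = fun x => - 2^-1 * D p x.
Proof. by rewrite alpha2E. Qed.

Lemma alpha2_3E : al 2 3%N = fun x => - 6^-1 * D d x.
Proof. by rewrite alpha2E. Qed.

Lemma alpha2_1E x :
  al 2 1%N x = 1 / 6 * (d x ^+ 2 + p x) * D d x + 1 / 2 * d x * D p x.
Proof.
rewrite alpha1E// sum2_4 alpha2_2E alpha2_3E.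
have [-> -> _ _] := full_sums (hp x) (- hm x).
move: (D d x) (D p x); rewrite /hdiff /hprod => Dd Dp; by field.
Qed.

Lemma alpha2_0E x : al 2 0%N x = 1 / 6 * d x * p x * D d x + 1 / 2 * p x * D p x.
Proof.
rewrite alpha0E// sum2_4 alpha2_2E alpha2_3E.
have [-> -> _ _] := inner_sums (hp x) (- hm x).
move: (D d x) (D p x); rewrite /hdiff /hprod => Dd Dp; by field.
Qed.

Lemma profile2E x xi : profile hp hm 2 x xi =
  - (xi ^+ 3 / 6 * D d x) - xi ^+ 2 / 2 * D p x + al 2 1%N x * xi + al 2 0%N x.
Proof.
rewrite profileSE// sum2_4 alpha2_2E alpha2_3E.
move: (al 2 1%N x) (al 2 0%N x) (D d x) (D p x) => a1 a0 Dd Dp; by field.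
Qed.

Let laplacian_scaled w (f : 'rV[R]_k -> R) (c : R) x : open w -> w x ->
  is_laplacian w f (D f) -> D (fun y => c * f y) x = c * D f x.
Proof. by move=> ow wx Hf; exact: (is_laplacianE (is_laplacianZ c ow Hf) wx). Qed.

Let F := D (fun y => d y * p y * D d y + 3 * p y * D p y).
Let G := D (fun y => (d y ^+ 2 + p y) * D d y + 3 * d y * D p y).

(* Keeps unification from unfolding one Laplacian against another. *)
Opaque alpha laplacian.

(** The functions under the outer Laplacians are constant multiples of the
    coefficients of the second profile, so only [is_laplacianZ] is needed to compare
    them with the recursion. *)
Lemma alpha3_expanded w x : open w -> w x ->
  (forall i, (i <= 3)%N -> is_laplacian w (al 2 i) (D (al 2 i))) ->
  [/\ al 3 2%N x = - 12^-1 * F x, al 3 3%N x = - 36^-1 * G x,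
      al 3 4%N x = 24^-1 * D (D p) x & al 3 5%N x = 120^-1 * D (D d) x].
Proof.
move=> ow wx H.
have DF : F x = 6 * D (al 2 0%N) x.
  rewrite -(laplacian_scaled 6 ow wx (H 0%N isT)); congr (D _ x).
  apply/funext => y; rewrite alpha2_0E.
  by move: (d y) (p y) (D d y) (D p y) => d' p' Dd Dp; field.
have DG : G x = 6 * D (al 2 1%N) x.
  rewrite -(laplacian_scaled 6 ow wx (H 1%N isT)); congr (D _ x).
  apply/funext => y; rewrite alpha2_1E.
  by move: (d y) (p y) (D d y) (D p y) => d' p' Dd Dp; field.
have DDp : D (D p) x = - 2 * D (al 2 2%N) x.
  rewrite -(laplacian_scaled (- 2) ow wx (H 2%N isT)); congr (D _ x).
  by apply/funext => y; rewrite alpha2_2E; move: (D p y) => Dp; field.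
have DDd : D (D d) x = - 6 * D (al 2 3%N) x.
  rewrite -(laplacian_scaled (- 6) ow wx (H 3%N isT)); congr (D _ x).
  by apply/funext => y; rewrite alpha2_3E; move: (D d y) => Dd; field.
move: (F x) (G x) (D (D p) x) (D (D d) x) DF DG DDp DDd => f g DDp DDd -> -> -> ->.
rewrite (@alpha3E 2)// (@alpha3E 3)// (@alpha3E 4)// (@alpha3E 5)//=.
move: (al 2 0%N) (al 2 1%N) (al 2 2%N) (al 2 3%N) => a0 a1 a2 a3.
split; set Da := D _ x; move: Da => Da; by field.
Qed.

Transparent alpha laplacian.

(** The outer Laplacians enter linearly and are treated as four unknowns, which makes
    the remaining identities polynomial in [hp x] and [hm x]. *)
Lemma order3_algebra (x : 'rV[R]_k) (f g DDp DDd : R) :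
  [/\ al 3 2%N x = - 12^-1 * f, al 3 3%N x = - 36^-1 * g,
      al 3 4%N x = 24^-1 * DDp & al 3 5%N x = 120^-1 * DDd] ->
  [/\ forall xi, profile hp hm 3 x xi =
        xi ^+ 5 / 120 * DDd + xi ^+ 4 / 24 * DDp
        - xi ^+ 3 / 36 * g - xi ^+ 2 / 12 * f
        + al 3 1%N x * xi + al 3 0%N x,
      al 3 1%N x =
        1 / 12 * d x * f
        + 1 / 36 * (d x ^+ 2 + p x) * g
        - 1 / 24 * d x * (d x ^+ 2 + 2 * p x) * DDp
        - 1 / 120 * (d x ^+ 4 + 3 * d x ^+ 2 * p x + p x ^+ 2) * DDd &
      al 3 0%N x =
        p x / 12 * f
        + d x * p x / 36 * g
        - 1 / 24 * p x * (d x ^+ 2 + p x) * DDp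
        - 1 / 120 * d x * p x * (d x ^+ 2 + 2 * p x) * DDd].
Proof.
move=> [e2 e3 e4 e5]; split=> [xi||].
- rewrite profileSE// sum2_6 e2 e3 e4 e5.
  by move: (al 3 1%N x) (al 3 0%N x) => a1 a0; field.
- rewrite alpha1E// sum2_6 e2 e3 e4 e5.
  have [-> -> -> ->] := full_sums (hp x) (- hm x).
  by rewrite /hdiff /hprod; field.
- rewrite alpha0E// sum2_6 e2 e3 e4 e5.
  have [-> -> -> ->] := inner_sums (hp x) (- hm x).
  by rewrite /hdiff /hprod; field.
Qed.

End ExplicitCoefficients.

(** * The error estimate *)

Section ErrorEstimate.
Context {R : realType} {k : nat} (w : set 'rV[R]_k) (hp hm : 'rV[R]_k -> R).
Variables (N : nat) (g : nat -> nat -> 'rV[R]_k -> R).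
Hypotheses (ow : open w) (hp_cont : {within closure w, continuous hp})
  (hm_cont : {within closure w, continuous hm}).
Hypothesis gE : forall j i, (1 <= j <= N)%N -> (i <= alpha_top j)%N ->
  is_cont_ext w (alpha hp hm j i) (g j i).

Definition extended_expansion (e : R) (x : 'rV[R]_k.+1) : R :=
  \sum_(1 <= j < N.+1) e ^+ (2 * j) *
    \sum_(0 <= i < (alpha_top j).+1) g j i (xprime x) * (xlast x / e) ^+ i.

Lemma extended_expansion_cont_ext e :
  is_cont_ext (thin_domain w hp hm e) (expansion hp hm N e) (extended_expansion e).
Proof.
split=> [|x [wx _]]; last first.
  apply: eq_big_nat => j jN; congr (_ * _); apply: eq_big_nat => i /andP[_ ij].
  by rewrite (gE jN ij).2.
apply: within_continuous_sum => j; rewrite mem_index_iota => jN.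
apply: within_continuousM; first exact: within_continuous_cst.
apply: within_continuous_sum => i; rewrite mem_index_iota => /andP[_ ij].
apply: within_continuousM; first exact: within_closure_thin (gE jN ij).1.
apply: within_continuousX; apply: within_continuousM.
  by apply: continuous_subspaceT; exact: xlast_continuous.
exact: within_continuous_cst.
Qed.

(** On the frontier xi equals h_+ or - h_-; substituting it turns the extension into a
    function of x' alone which is continuous on the closure of [w] and zero on [w]. *)
Lemma extended_expansion_frontier e x : e != 0 ->
  (forall y, frontier w y -> hm y + hp y = 0) ->
  frontier (thin_domain w hp hm e) x -> extended_expansion e x = 0.
Proof.
move=> e0 H0 /(frontier_thin_domain ow hp_cont hm_cont H0)[cwx xE].
have vanish (s : 'rV[R]_k -> R) : {within closure w, continuous s} ->
    (forall y, s y = hp y \/ s y = - hm y) -> xlast x / e = s (xprime x) ->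
    extended_expansion e x = 0.
  move=> cs sE xs.
  pose q y := \sum_(1 <= j < N.+1) e ^+ (2 * j) *
      \sum_(0 <= i < (alpha_top j).+1) g j i y * s y ^+ i.
  have -> : extended_expansion e x = q (xprime x) by rewrite /q -xs.
  apply: (@within_closure_eq0 R _ w q _ _ _ cwx).
    apply: within_continuous_sum => j; rewrite mem_index_iota => jN.
    apply: within_continuousM; first exact: within_continuous_cst.
    apply: within_continuous_sum => i; rewrite mem_index_iota => /andP[_ ij].
    by apply: within_continuousM; [exact: (gE jN ij).1|exact: within_continuousX].
  move=> y wy; apply: big1_seq => j /=; rewrite mem_index_iota => jN.
  rewrite -[RHS](mulr0 (e ^+ (2 * j))); congr (_ * _).
  rewrite -[RHS](@profile_boundary _ _ hp hm j y (s y))//; last by case/andP: jN.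
  by rewrite /profile; apply: eq_big_nat => i /andP[_ ij]; rewrite (gE jN ij).2.
case: xE => xE.
  by apply: (vanish hp) => //; [left|rewrite xE mulrAC divff ?mul1r].
apply: (vanish (fun y => -1 * hm y)).
- by apply: within_continuousM hm_cont; exact: within_continuous_cst.
- by move=> y; right; rewrite mulN1r.
- by rewrite xE mulN1r mulNr mulrAC divff ?mul1r.
Qed.


(** The constant is (K + 1) M^2, where M bounds the heights, K bounds the x'-Laplacian
    of the last profile, and the 1 gives the strict inequality that the maximum
    principle asks for. *)
Lemma expansion_error (H0 : forall x, frontier w x -> hm x + hp x = 0)
    (w_bnd : bounded_set w) (N_ge1 : (1 <= N)%N)
    (alpha_C2 : forall j i, (1 <= j <= N)%N -> (i <= alpha_top j)%N ->
       Cn_closure 2 w (alpha hp hm j i)) :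
  exists C : R, forall e u, 0 < e -> torsion_solution (thin_domain w hp hm e) u ->
    forall x, closure (thin_domain w hp hm e) x ->
      `|u x - extended_expansion e x| <= C * e ^+ (2 * N + 2).
Proof.
have cw := compact_closure_bounded w_bnd.
have [M1 hpM1] := within_closure_bounded cw hp_cont.
have [M2 hmM2] := within_closure_bounded cw hm_cont.
pose M : R := Num.max M1 M2.
have hpM y : w y -> `|hp y| <= M.
  by move=> /subset_closure/hpM1 yM; rewrite le_max yM.
have hmM y : w y -> `|hm y| <= M.
  by move=> /subset_closure/hmM2 yM; rewrite le_max yM orbT.
have [K LK] : exists K, forall t : 'rV[R]_k * R, w t.1 /\ `|t.2| <= M ->
    `|profile_laplacian hp hm N t.1 t.2| <= K.
  apply: bounded_sum => i; rewrite mem_index_iota => /andP[_ iN].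
  have NN : (1 <= N <= N)%N by rewrite N_ge1 leqnn.
  have [B BP] := laplacian_bounded cw (alpha_C2 N i NN iN).
  exists (B * M ^+ i) => -[y xi] /= [wy xiM].
  by rewrite normrM normrX ler_pM// ?exprn_ge0// ?BP// lerXn2r ?nnegrE// (le_trans _ xiM).
exists ((K + 1) * M ^+ 2) => e u e0 [uC2 u_cont uE u0] x cTx.
set T := thin_domain w hp hm e in uC2 u_cont uE u0 cTx *.
have oT : open T by exact: open_thin_domain.
have e_neq0 : e != 0 by rewrite gt_eqF.
have [v_cont vE] := extended_expansion_cont_ext e.
have TM y : T y -> `|xlast y| <= e * M.
  by apply: thin_domain_xlast_le => //; exact: ltW.
have TW : T `<=` @xprime R k @^-1` w by move=> y [].
have lapl_v : is_laplacian T (extended_expansion e) (fun y =>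
    -2 + e ^+ (2 * N) * profile_laplacian hp hm N (xprime y) (xlast y / e)).
  apply: (near_is_laplacian oT (f := expansion hp hm N e)).
    by move=> y Ty; rewrite vE.
  apply: is_laplacian_sub TW _; apply: is_laplacian_expansion => // j i jN ij.
  exact/is_laplacian_Cn_closure2/alpha_C2.
have lapl_f := is_laplacianD oT (is_laplacian_Cn2 uC2)
  (is_laplacianZ (-1) oT lapl_v).
have -> : (K + 1) * M ^+ 2 * e ^+ (2 * N + 2) =
    e ^+ (2 * N) * (K + 1) * (e * M) ^+ 2 by rewrite exprD exprMn; ring.
rewrite -[- extended_expansion e x]mulN1r.
apply: (slab_estimate oT _ lapl_f _ TM) cTx.
- exact: bounded_thin_domain TM.
- apply: within_continuousD => //.
  by apply: within_continuousM v_cont; exact: within_continuous_cst.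
- move=> y Ty; have := uE y Ty; set Du := laplacian u y => uy.
  have -> : Du = -2 by rewrite -uy opprK.
  set Ly := profile_laplacian _ _ _ _ _.
  have -> : -2 + -1 * (-2 + e ^+ (2 * N) * Ly) = - (e ^+ (2 * N) * Ly) by ring.
  rewrite normrN normrM ger0_norm ?exprn_ge0 ?(ltW e0)//.
  rewrite ltr_pM2l ?exprn_gt0//; apply: le_lt_trans (_ : K < K + 1); last first.
    by rewrite ltrDl.
  apply: (LK (xprime y, xlast y / e)); split; first by case: Ty.
  by rewrite normrM normfV (gtr0_norm e0) ler_pdivrMr// mulrC; exact: TM.
- by move=> y Fy; rewrite u0// extended_expansion_frontier// mulr0 addr0.
Qed.

End ErrorEstimate.

(* The dimension is n = m + 2; omega lies in R^(n-1), Omega_eps in R^n. *)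
Theorem theorem1 (R : realType) (m : nat) (w : set 'rV[R]_m.+1)
    (hp hm : 'rV[R]_m.+1 -> R) (N : nat) (u : R -> 'rV[R]_m.+2 -> R)
    (w_dom : domain w) (w_bnd : bounded_set w) (w_C1 : C1_boundary w)
    (hp_cont : {within closure w, continuous hp}) (hp_C1 : Cn 1 w hp)
    (hm_cont : {within closure w, continuous hm}) (hm_C1 : Cn 1 w hm)
    (H_gt0 : forall x, w x -> 0 < hm x + hp x)
    (H_eq0 : forall x, frontier w x -> hm x + hp x = 0)
    (u_sol : \forall e \near 0^'+, torsion_solution (thin_domain w hp hm e) (u e))
    (N_ge1 : (1 <= N)%N)
    (alpha_C2 : forall j i : nat, (1 <= j <= N)%N -> (i <= alpha_top j)%N ->
       Cn_closure 2 w (alpha hp hm j i)) :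
  let d := hdiff hp hm in
  let p := hprod hp hm in
  let D := @laplacian R m.+1 in
  let al := alpha hp hm in
  [/\ exists C : R, \forall e \near 0^'+,
        exists v : 'rV[R]_m.+2 -> R,
          is_cont_ext (thin_domain w hp hm e) (expansion hp hm N e) v /\
          (forall x, closure (thin_domain w hp hm e) x ->
             `|u e x - v x| <= C * e ^+ (2 * N + 2)),
      forall x xi, w x ->
        profile hp hm 1 x xi = - xi ^+ 2 + xi * d x + p x,
      (2 <= N)%N -> forall x, w x ->
        [/\ forall xi, profile hp hm 2 x xi =
              - (xi ^+ 3 / 6 * D d x) - xi ^+ 2 / 2 * D p x
              + al 2%N 1%N x * xi + al 2%N 0%N x,
            al 2%N 1%N x = 1 / 6 * (d x ^+ 2 + p x) * D d x + 1 / 2 * d x * D p x &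
            al 2%N 0%N x = 1 / 6 * d x * p x * D d x + 1 / 2 * p x * D p x] &
      (3 <= N)%N ->
        let F := D (fun y => d y * p y * D d y + 3 * p y * D p y) in
        let G := D (fun y => (d y ^+ 2 + p y) * D d y + 3 * d y * D p y) in
        forall x, w x ->
        [/\ forall xi, profile hp hm 3 x xi =
              xi ^+ 5 / 120 * D (D d) x + xi ^+ 4 / 24 * D (D p) x
              - xi ^+ 3 / 36 * G x - xi ^+ 2 / 12 * F x
              + al 3%N 1%N x * xi + al 3%N 0%N x,
            al 3%N 1%N x =
              1 / 12 * d x * F x
              + 1 / 36 * (d x ^+ 2 + p x) * G x
              - 1 / 24 * d x * (d x ^+ 2 + 2 * p x) * D (D p) x
              - 1 / 120 * (d x ^+ 4 + 3 * d x ^+ 2 * p x + p x ^+ 2) * D (D d) x &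
            al 3%N 0%N x =
              p x / 12 * F x
              + d x * p x / 36 * G x
              - 1 / 24 * p x * (d x ^+ 2 + p x) * D (D p) x
              - 1 / 120 * d x * p x * (d x ^+ 2 + 2 * p x) * D (D d) x]].
Proof.
move=> d p D al; have [ow _ _] := w_dom.
have alpha_lapl j i : (1 <= j <= N)%N -> (i <= alpha_top j)%N ->
    is_laplacian w (al j i) (D (al j i)).
  by move=> jN ij; exact/is_laplacian_Cn_closure2/alpha_C2.
split.
- have ext (ji : nat * nat) : exists g, (1 <= ji.1 <= N)%N ->
      (ji.2 <= alpha_top ji.1)%N -> is_cont_ext w (alpha hp hm ji.1 ji.2) g.
    case: ji => j i /=.
    have [jN|] := boolP (1 <= j <= N)%N; last by exists (fun=> 0).
    have [ij|] := boolP (i <= alpha_top j)%N; last by exists (fun=> 0).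
    by have [[g gE] _] := alpha_C2 j i jN ij; exists g.
  have [g gE] := choice ext.
  have {}gE j i := gE (j, i).
  have [C CP] := expansion_error ow hp_cont hm_cont gE H_eq0 w_bnd N_ge1 alpha_C2.
  exists C; near=> e; exists (extended_expansion N (fun j i => g (j, i)) e); split.
    exact: extended_expansion_cont_ext.
  have e0 : 0 < e by near: e; exact: nbhs_right_gt.
  by apply: CP => //; near: e.
- by move=> x xi _; exact: profile1E.
- move=> _ x _; split=> [xi||].
  + exact: profile2E.
  + exact: alpha2_1E.
  + exact: alpha2_0E.
- move=> N3 F G x wx; apply: order3_algebra; apply: (alpha3_expanded ow wx) => i i3.
  by apply: alpha_lapl => //; rewrite (leq_trans _ N3).
Unshelve. all: by end_near. Qed.
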